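(* Let $r\in[-\infty,-1)$. Then for every $K\in\{2,3,\dots\}$ the function $\frac{r}{r+1}K^{1+1/r}M_{r,K}$ is a merging function on $[0,1]^K$, and the family $\frac{r}{r+1}K^{1+1/r}M_{r,K}$, $K=2,3,\dots$, is asymptotically precise. Here $\frac{r}{r+1}$ is understood as $1$ and $K^{1+1/r}$ as $K$ when $r=-\infty$.
   Context: Generalized means on $[0,1]^K$: for $r\in(-\infty,0)$, $M_{r,K}(p_1,\dots,p_K):=\left(\frac{p_1^r+\dots+p_K^r}{K}\right)^{1/r}$, with conventions $0^c:=\infty$ for $c<0$, $\infty+c:=\infty$, $\infty^c:=0$ for $c<0$; $M_{-\infty,K}(p_1,\dots,p_K):=\min(p_1,\dots,p_K)$. Fix an atomless probability space and let $\mathcal{U}$ be the set of all random variables on it uniformly distributed on $[0,1]$. A merging function is a Borel function $F:[0,1]^K\to[0,\infty)$, increasing (in the weak sense) in each argument, such that for each $\epsilon\in(0,1)$, $\sup\{\mathbb{P}(F(U_1,\dots,U_K)\le\epsilon)\mid U_1,\dots,U_K\in\mathcal{U}\}\le\epsilon$. A family $F_K$, $K=2,3,\dots$, of merging functions on $[0,1]^K$ is asymptotically precise if for every $a\in(0,1)$ the function $aF_K$ is not a merging function for all large enough $K$ (i.e. there is $K_0$ such that for every $K\ge K_0$, $aF_K$ is not a merging function). *)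

(* Defs.v *)
From HB Require Import structures.
From mathcomp Require Import all_boot all_order all_algebra.
From mathcomp Require Import all_classical all_reals all_analysis.
Set Implicit Arguments.
Unset Strict Implicit.
Unset Printing Implicit Defensive.
Import Order.TTheory GRing.Theory Num.Theory.
Import numFieldNormedType.Exports.
Local Open Scope classical_set_scope.
Local Open Scope ring_scope.

Definition atomless (d : measure_display) (T : measurableType d) (R : realType)
    (P : probability T R) : Prop :=
  forall A : set T, measurable A -> (0 < P A)%E ->
    exists B : set T, [/\ measurable B, B `<=` A, (0 < P B)%E & (P B < P A)%E].

Definition uniform01 (d : measure_display) (T : measurableType d)
    (R : realType) (P : probability T R) (X : {RV P >-> R}) : Prop :=
  forall A : set R, measurable A ->
    distribution P X A = uniform_prob (@ltr01 R) A.

Definition unit_cube (R : realType) (K : nat) : set (K.-tuple R) :=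
  [set p | forall i, 0 <= tnth p i <= 1].

(* A function on [0,1]^K is represented by a function on K.-tuple R of which
   only the values on the cube are ever used. A variable with uniform law may
   leave [0,1] on a null set, where F(U_1,...,U_K) has no meaning; such
   outcomes are left out of the event. *)
Definition le_event (d : measure_display) (T : measurableType d) (R : realType)
    (P : probability T R) (K : nat) (F : K.-tuple R -> R)
    (U : 'I_K -> {RV P >-> R}) (e : R) : set T :=
  [set w | unit_cube [tuple U i w | i < K] /\ F [tuple U i w | i < K] <= e].

Definition merging_function (d : measure_display) (T : measurableType d)
    (R : realType) (P : probability T R) (K : nat) (F : K.-tuple R -> R)
    : Prop :=
  [/\ measurable_fun (@unit_cube R K) F,
      forall p, unit_cube p -> 0 <= F p,
      forall p q (i : 'I_K), unit_cube p -> unit_cube q ->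
        (forall j, j != i -> tnth p j = tnth q j) ->
        tnth p i <= tnth q i -> F p <= F q
    & forall e : R, 0 < e < 1 ->
        (ereal_sup [set P (le_event F U e) | U in
           [set U : 'I_K -> {RV P >-> R} | forall i, uniform01 (U i)]]
         <= e%:E)%E].

Definition asymptotically_precise (d : measure_display) (T : measurableType d)
    (R : realType) (P : probability T R) (F : forall K : nat, K.-tuple R -> R)
    : Prop :=
  forall a : R, 0 < a < 1 ->
    exists K0 : nat, forall K : nat, (2 <= K)%N -> (K0 <= K)%N ->
      ~ merging_function P (fun p : K.-tuple R => a * F K p).

(* x^c for x in [0,+oo] and c < 0, with 0^c = +oo and (+oo)^c = 0; the
   library's poweR has other values at 0 and +oo. *)
Definition neg_power (R : realType) (x : \bar R) (c : R) : \bar R :=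
  match x with
  | x'%:E => if x' == 0 then +oo%E else (x' `^ c)%:E
  | _ => 0%E
  end.

(* Used for r in [-oo, 0); the value at r = +oo is irrelevant. *)
Definition gen_mean (R : realType) (r : \bar R) (K : nat) (p : K.-tuple R)
    : \bar R :=
  match r with
  | r'%:E => neg_power ((\sum_(i < K) neg_power (tnth p i)%:E r')
                          * (K%:R^-1)%:E)%E r'^-1
  | -oo%E => \big[mine/+oo%E]_(i < K) (tnth p i)%:E
  | +oo%E => 0%E
  end.

Definition mean_coef (R : realType) (r : \bar R) (K : nat) : R :=
  match r with
  | r'%:E => r' / (r' + 1) * K%:R `^ (1 + r'^-1)
  | -oo%E => K%:R
  | +oo%E => 0
  end.

(* On [0,1]^K with K > 0 the mean lies in [0,1], so fine loses nothing. *)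
Definition scaled_mean (R : realType) (r : \bar R) (K : nat) (p : K.-tuple R)
    : R :=
  mean_coef r K * fine (gen_mean r p).

(* Main.v *)
Require Import Defs.
From HB Require Import structures.
From mathcomp Require Import all_boot all_order all_algebra perm.
From mathcomp Require Import all_classical all_reals all_analysis.
From mathcomp Require Import measurable_realfun ring lra.
Import Order.TTheory GRing.Theory Num.Theory.
Import numFieldNormedType.Exports.
Local Open Scope classical_set_scope.
Local Open Scope ring_scope.
Set Implicit Arguments.
Unset Strict Implicit.
Unset Printing Implicit Defensive.

(** Both halves rest on the same dual certificate.  Let [q = - (r + 1) > 0],
    [c = (r + 1) / r < 1] and [u = c e / K].  On the cube the scaled mean is at
    most [e] exactly when some coordinate vanishes or the sum of the [p_i ^ r]
    is at least [u ^ r].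

    Validity.  Put [phi x = 1] for [x <= u] and [phi x = (x / u) ^ r] for
    [x > u].  The event forces [\sum_i phi (U_i) >= 1], so its probability is
    at most [K \int_0^1 phi <= K u / c = e], whatever the dependence between
    the [U_i] (lemmas [prob_le_event_dual] and [integral_capped_power]).  For
    [r = -oo] the indicator of [x <= e / K] plays the role of [phi].

    Precision.  Fix [a < 1], take [e] in [(a, 1)] and [b = e / a > 1].  It
    suffices to find uniform [U_i] whose scaled mean is at most [b] with
    probability greater than [e].  Split [0, 1] into [n K] cells, and deal the
    first [m] cells, [m] independent of [K], into [n] groups such that all but
    a small fraction of the groups have a sum of [t ^ r] (over the numbers [t],
    counted from 1, of their cells) of at least [(c b n) ^ r]; this is
    [harmonic_covering].  Rows of an [n x K] array then stand for the groups,
    and by cyclic shifts of the rows each [U_i] becomes a rearrangement of the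
    cells of one uniform variable, hence is uniform, while on a row the [U_i]
    jointly visit all cells of its group ([uniform_arrangement]).

    The groups come from a greedy packing.  The first [k] cells are one group
    each, and the others are dealt into about [k / q] groups of capacity [T],
    their total weight divided by the number of groups; [T] is about [k ^ r].
    A cell that fits nowhere would mean that every group is filled above [T]
    minus its weight, and comparing the weight not yet dealt with an integral
    shows that this cannot happen.  So every cell is placed, no group exceeds
    [T] while the loads almost add up to the total capacity, and hence almost
    all groups are almost full ([tail_covering]).

    The uniform variable comes from Sierpinski's theorem: in an atomless space
    a nested family of sets indexed by the dyadic numbers between 0 and 1 can
    be chosen whose probabilities are their indices ([uniform_variable]). *)

(** * Powers with a negative exponent *)

Lemma powR_invl (R : realType) (x r : R) : 0 <= x -> x^-1 `^ r = (x `^ r)^-1.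
Proof. by move=> x0; rewrite -[x^-1]powR_inv1// -powRrM mulN1r powRN. Qed.

Lemma powR_lt0_le (R : realType) (r x y : R) : r < 0 -> 0 < x -> 0 < y ->
  (x `^ r <= y `^ r) = (y <= x).
Proof.
move=> r0 x0 y0; rewrite /powR !gt_eqF// ler_expR ler_nM2l//.
by rewrite ler_ln.
Qed.

Section negative_powers.
Context (R : realType) (q : R) (q0 : 0 < q).

Lemma ler_powRN (x y : R) : 0 < x -> x <= y -> y `^ (- q) <= x `^ (- q).
Proof.
by move=> x0 xy; rewrite powR_lt0_le ?oppr_lt0// (lt_le_trans x0).
Qed.

Lemma powRN_small (e : R) : 0 < e ->
  exists m : nat, forall x, m%:R <= x -> x `^ (- q) <= e.
Proof.
move=> e0; exists (Num.bound (e^-1 `^ q^-1)) => x mx.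
have lt : e^-1 `^ q^-1 < x.
  by apply: lt_le_trans mx; rewrite archi_boundP// powR_ge0.
have x0 : 0 < x by apply: le_lt_trans lt; exact: powR_ge0.
have e1 : 0 < e^-1 by rewrite invr_gt0.
rewrite powRN -[leRHS]invrK lef_pV2 ?posrE ?powR_gt0//.
have -> : e^-1 = (e^-1 `^ q^-1) `^ q.
  by rewrite -powRrM mulVf ?gt_eqF// powRr1// ltW.
by rewrite ge0_ler_powR ?nnegrE ?powR_ge0// ltW.
Qed.

Lemma powRN_succ (z : R) : 0 < z -> z `^ (- (q + 1)) = z `^ (- q) / z.
Proof.
move=> z0; rewrite opprD powRD ?powR_inv1 ?ltW//.
by apply/implyP => _; rewrite gt_eqF.
Qed.

(** The graph of the convex function [x `^ (- q)] lies above its tangent at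
    [y]. *)
Lemma powR_tangent (x y : R) : 0 < x -> 0 < y ->
  y `^ (- q) * (1 - q * ((x - y) / y)) <= x `^ (- q).
Proof.
move=> x0 y0; have -> : x `^ (- q) = y `^ (- q) * expR (- (q * ln (x / y))).
  rewrite /powR !gt_eqF// -expRD ln_div ?posrE//; congr expR; ring.
rewrite ler_pM2l ?powR_gt0//; apply: le_trans (expR_ge1Dx _).
rewrite lerD2l lerN2 ler_pM2l// mulrBl divff ?gt_eqF//.
have : ln (1 + (x / y - 1)) <= x / y - 1.
  by apply: le_ln1Dx; have := divr_gt0 x0 y0; lra.
by rewrite addrC subrK.
Qed.

(** The mean value theorem for [x `^ (- q)] between [x] and [x + 1], read off
    from the tangents at both ends. *)
Lemma powR_increment (x : R) : 0 < x ->
  q * (x + 1) `^ (- (q + 1)) <= x `^ (- q) - (x + 1) `^ (- q)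
    <= q * x `^ (- (q + 1)).
Proof.
move=> x0; have x10 : 0 < x + 1 by lra.
rewrite !powRN_succ//; apply/andP; split.
  by have := powR_tangent x0 x10; lra.
by have := powR_tangent x10 x0; lra.
Qed.

(** Comparison of the sum with the integral of [q * x `^ (- (q + 1))], by
    telescoping the increments of [x `^ (- q)]. *)
Lemma sum_powR_bounds (x : R) (m : nat) : 0 < x ->
  (x + 1) `^ (- q) - (x + 1 + m%:R) `^ (- q)
    <= q * \sum_(i < m) (x + 1 + i%:R) `^ (- (q + 1))
    <= x `^ (- q) - (x + m%:R) `^ (- q).
Proof.
move=> x0; elim: m => [|m IH].
  by rewrite big_ord0 !addr0 !subrr mulr0 lexx.
have m0 : 0 <= m%:R :> R by [].
have /andP[_ up] := powR_increment (x := x + 1 + m%:R) ltac:(lra).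
have /andP[lo _] := powR_increment (x := x + m%:R) ltac:(lra).
rewrite big_ord_recr/= -natr1 mulrDr !addrA.
rewrite (_ : x + 1 + m%:R = x + m%:R + 1) in IH up *; last by rewrite addrAC.
lra.
Qed.

End negative_powers.

(** * Greedy packing *)

(** If an item [w j] fits in none of the bins, every load exceeds [T - w j];
    summing over the bins contradicts the hypothesis on [j]. *)
Lemma greedy_packing (R : realDomainType) (N m : nat) (w : nat -> R) (T : R) :
  0 <= T ->
  (forall j, (j < m)%N -> \sum_(i < j) w i + N.+1%:R * w j <= N.+1%:R * T) ->
  exists f : nat -> 'I_N.+1, forall b, \sum_(i < m | f i == b) w i <= T.
Proof.
move=> T0; elim: m => [|m IH] fits.
  by exists (fun=> ord0) => b; rewrite big_ord0.
have [|f fP] := IH; first by move=> j jm; apply: fits; rewrite ltnS ltnW.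
have [b0 fb0] : exists b0, \sum_(i < m | f i == b0) w i + w m <= T.
  apply/existsP; apply: contraT; rewrite negb_exists => /forallP full.
  have := fits m (ltnSn m); rewrite leNgt => /negP[].
  rewrite (partition_big (fun i : 'I_m => f i) xpredT)//=.
  have const (x : R) : N.+1%:R * x = \sum_(b < N.+1) x.
    by rewrite sumr_const card_ord mulr_natl.
  rewrite !const -big_split/=; apply: ltr_sum.
    by apply/hasP; exists ord0; rewrite ?mem_index_enum.
  by move=> b _; rewrite ltNge.
exists (fun i => if i == m then b0 else f i) => b.
rewrite big_mkcond big_ord_recr/= eqxx.
rewrite (eq_bigr (fun i : 'I_m => if f i == b then w i else 0)); last first.
  by move=> i _; rewrite ltn_eqF.
rewrite -big_mkcond; case: eqP => [<-|_]//; by rewrite addr0.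
Qed.

(** Markov's inequality for the missing loads [T - load b]. *)
Lemma card_nearly_full (R : realFieldType) (N : nat) (load : 'I_N -> R)
    (T e : R) :
  0 < T -> 0 < e -> (forall b, load b <= T) ->
  (1 - e ^+ 2) * (N%:R * T) <= \sum_b load b ->
  (1 - e) * N%:R <= #|[pred b | (1 - e) * T <= load b]|%:R.
Proof.
move=> T0 e0 leT total.
pose G := [pred b | (1 - e) * T <= load b].
have cardG : #|G|%:R + #|predC G|%:R = N%:R :> R.
  by rewrite -natrD cardC card_ord.
have : \sum_b load b <= #|G|%:R * T + #|predC G|%:R * ((1 - e) * T).
  rewrite (bigID (mem G))/= !mulr_natl -!sumr_const lerD//.
    exact: ler_sum.
  by apply: ler_sum => b; rewrite inE -ltNge => /ltW.
move=> /(le_trans total); rewrite -cardG => h.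
have : #|predC G|%:R <= e * (#|G|%:R + #|predC G|%:R).
  rewrite -(ler_pM2l T0) -(ler_pM2l e0); move: h; lra.
lra.
Qed.

Section covering.
Context (R : realType) (q : R) (q0 : 0 < q).

(** The capacity [T] is chosen such that [N.+1 * T] is the integral bound
    [k `^ (- q) / q] for the weight of all cells beyond [k].  The item [j] fits
    because the capacity left, at least [(k + j) `^ (- q) / q], is not less
    than [N.+1] times the item, by [q * N.+1 <= k]. *)
Lemma tail_covering (k N : nat) (e : R) : 0 < e -> (0 < k)%N ->
  q * N.+1%:R <= k%:R -> 2 * q <= e ^+ 2 * k%:R ->
  exists (m : nat) (f : nat -> 'I_N.+1),
    (1 - e) * N.+1%:R <= #|[pred b | (1 - e) * k%:R `^ (- (q + 1)) <=
       \sum_(i < m | f i == b) (k + i).+1%:R `^ (- (q + 1))]|%:R.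
Proof.
move=> e0 k0 Nk ek; have N0 : 0 < N.+1%:R :> R by [].
have [e1|e1] := leP 1 e.
  exists 0%N, (fun=> ord0); apply: le_trans (ler0n _ _).
  by rewrite mulr_le0_ge0// subr_le0.
have k0R : 0 < k%:R :> R by rewrite ltr0n.
pose w i : R := (k + i).+1%:R `^ (- (q + 1)).
pose T := k%:R `^ (- q) / (q * N.+1%:R).
have NT : q * (N.+1%:R * T) = k%:R `^ (- q).
  by rewrite /T mulrA mulrCA divff ?mulr1// mulf_neq0// gt_eqF.
have T0 : 0 < T by rewrite divr_gt0 ?powR_gt0 ?mulr_gt0.
have kT : k%:R `^ (- (q + 1)) <= T.
  by rewrite powRN_succ// /T ler_pM2l ?powR_gt0// lef_pV2 ?posrE ?mulr_gt0.
have sumE m : \sum_(i < m) w i = \sum_(i < m) (k%:R + 1 + i%:R) `^ (- (q + 1)).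
  by apply: eq_bigr => i _; rewrite /w -addSn natrD natr1.
have up m : q * \sum_(i < m) w i <= k%:R `^ (- q) - (k%:R + m%:R) `^ (- q).
  by rewrite sumE; have /andP[] := sum_powR_bounds q0 m k0R.
have lo m : (k%:R + 1) `^ (- q) - (k%:R + 1 + m%:R) `^ (- q)
    <= q * \sum_(i < m) w i.
  by rewrite sumE; have /andP[] := sum_powR_bounds q0 m k0R.
have fits j : \sum_(i < j) w i + N.+1%:R * w j <= N.+1%:R * T.
  rewrite -(ler_pM2l q0) NT mulrDr.
  have j0 : 0 < k%:R + j%:R :> R by rewrite -natrD ltr0n addn_gt0 k0.
  have : q * (N.+1%:R * w j) <= (k%:R + j%:R) `^ (- q).
    rewrite /w powRN_succ// mulrA.
    apply: (@le_trans _ _ ((k + j).+1%:R `^ (- q))).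
      rewrite mulrA ler_pdivrMr// mulrC ler_wpM2l ?powR_ge0//.
      by rewrite (le_trans Nk)// ler_nat -addnS leq_addr.
    by apply: ler_powRN => //; rewrite -natrD ler_nat.
  by have := up j; lra.
(* With this [m] the items beyond the first [m] account for at most half of
   the loss [e ^+ 2] allowed by [card_nearly_full]; the other half pays for
   the step from [k] to [k + 1] in the lower bound for the sum. *)
have [|m mP] := @powRN_small R q q0 (e ^+ 2 / 2 * k%:R `^ (- q)).
  by rewrite mulr_gt0 ?powR_gt0 ?divr_gt0 ?exprn_gt0.
have [f fP] := @greedy_packing R N m w T (ltW T0) (fun j _ => fits j).
exists m, f; apply: le_trans (card_nearly_full T0 e0 fP _) _.
  have -> : \sum_b \sum_(i < m | f i == b) w i = \sum_(i < m) w i.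
    by rewrite [RHS](partition_big (fun i : 'I_m => f i) xpredT).
  rewrite -(ler_pM2l q0).
  apply: le_trans (lo m); rewrite mulrCA NT.
  have := mP (k%:R + 1 + m%:R) ltac:(rewrite lerDr; lra).
  have := powR_tangent q0 (x := k%:R + 1) (y := k%:R) ltac:(lra) k0R.
  rewrite addrAC subrr add0r div1r.
  have : q / k%:R <= e ^+ 2 / 2 by rewrite ler_pdivrMr//; lra.
  move=> /(ler_wpM2l (powR_ge0 k%:R (- q))); lra.
rewrite ler_nat; apply: subset_leq_card; apply/fintype.subsetP => b.
rewrite !inE.
by apply: le_trans; rewrite ler_pM2l// subr_gt0.
Qed.

(** With [k] groups of one cell and [N.+1 = trunc (k / q)] further groups, the
    number of groups is [n = k + N.+1], about [k (q + 1) / q]; the target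
    [q / (q + 1) * b * n] is thus above [k] by a factor close to [b], and this
    slack absorbs the rounding of [n] and the loss [e] of
    [tail_covering]. *)
Lemma harmonic_covering (b e : R) : 1 < b -> 0 < e ->
  exists (n m : nat) (f : nat -> 'I_n) (good : pred 'I_n),
  [/\ (0 < n)%N, (1 - e) * n%:R <= #|good|%:R &
    forall g, good g -> (q / (q + 1) * b * n%:R) `^ (- (q + 1)) <=
      \sum_(t < m | f t == g) t.+1%:R `^ (- (q + 1))].
Proof.
move=> b1 e0; pose p := q + 1; pose c := (1 + b) / 2.
have p0 : 0 < p by rewrite addr_gt0.
have c1 : 1 < c by rewrite /c; lra.
have cp1 : c `^ (- p) < 1.
  rewrite powRN invf_lt1 ?powR_gt0 ?(lt_trans ltr01)//.
  have : 1 `^ p < c `^ p.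
    by rewrite gt0_ltr_powR ?nnegrE// ltW// (lt_trans ltr01).
  by rewrite powR1.
have [h [h0 he hc]] : exists h, [/\ 0 < h, h <= e & h <= 1 - c `^ (- p)].
  exists (Num.min e (1 - c `^ (- p))).
  by rewrite lt_min e0 subr_gt0 !ge_min !lexx orbT.
have q2 : 0 <= 2 * q / h ^+ 2.
  by rewrite divr_ge0 ?exprn_ge0 ?mulr_ge0 ?(ltW h0) ?(ltW q0).
have b2 : 0 <= 2 * b / (b - 1) by rewrite divr_ge0 ?mulr_ge0//; lra.
have large (x y z : R) : 0 <= x -> 0 <= y -> 0 <= z ->
    exists k : nat, [/\ 0 < k%:R :> R, x <= k%:R, y <= k%:R & z <= k%:R].
  move=> x0 y0 z0; exists (Num.bound (x + y + z)).+1; rewrite ltr0n -natr1.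
  by have := archi_boundP (addr_ge0 (addr_ge0 x0 y0) z0); split => //; lra.
have [k [k0 qk]] := large _ _ _ (ltW q0) q2 b2.
rewrite !ler_pdivrMr ?exprn_gt0 ?subr_gt0// => hk2 bk.
have /andP[Nq qN] := truncn_itv (divr_ge0 (ltW k0) (ltW q0)).
have : (0 < Num.trunc (k%:R / q))%N by rewrite truncn_gt0 ler_pdivlMr// mul1r.
case: (Num.trunc (k%:R / q)) Nq qN => // N Nq qN _.
have [|||m [f card_good]] := @tail_covering k N h h0.
- by rewrite -(ltr0n R).
- by rewrite mulrC -ler_pdivlMr.
- by rewrite [leRHS]mulrC.
pose F t : 'I_(k + N.+1) :=
  if insub t is Some i then @lshift k N.+1 i else @rshift k N.+1 (f (t - k)%N).
pose G' := [pred b | (1 - h) * k%:R `^ (- p) <=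
  \sum_(i < m | f i == b) (k + i).+1%:R `^ (- p)].
pose G : pred 'I_(k + N.+1) := fun g =>
  if fintype.split g is inr b then G' b else true.
have target : (q / (q + 1) * b * (k + N.+1)%:R) `^ (- p)
    <= (1 - h) * k%:R `^ (- p).
  have ck0 : 0 < c * k%:R by rewrite mulr_gt0// (lt_trans ltr01).
  apply: (@le_trans _ _ ((c * k%:R) `^ (- p))).
    apply: ler_powRN => //.
    have qc : k%:R - 1 <= q / (q + 1) * (k + N.+1)%:R.
      move: qN; rewrite ltr_pdivrMr// natrD -[in X in X -> _]natr1 => qN.
      rewrite mulrAC ler_pdivlMr//; lra.
    rewrite -mulrA mulrCA; apply: le_trans (ler_wpM2l _ qc); rewrite /c; lra.
  rewrite powRM ?(ltW k0)// ?(le_trans ler01 (ltW c1))//.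
  rewrite ler_wpM2r ?powR_ge0// lerBrDr -lerBrDl.
  by [].
exists (k + N.+1)%N, (k + m)%N, F, G; split => //.
- by rewrite addnS.
- have -> : #|G| = (k + #|G'|)%N.
    rewrite -sum1_card big_split_ord/= -[in RHS]sum1_card; congr (_ + _)%N.
      rewrite (eq_bigl xpredT) ?sum1_card ?card_ord// => i.
      by rewrite unfold_in /G -[lshift _ _]/(unsplit (inl i)) unsplitK.
    apply: eq_bigl => i.
    by rewrite unfold_in /G -[rshift _ _]/(unsplit (inr i)) unsplitK.
  rewrite !natrD mulrDr; apply: lerD.
    rewrite -[leRHS]mul1r ler_wpM2r//; lra.
  by apply: le_trans card_good; rewrite ler_wpM2r// lerD2l lerN2.
move=> g; rewrite /G big_mkcond big_split_ord/=.
rewrite -[g]splitK; case: (fintype.split g) => [j|b'] /=.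
  move=> _; rewrite -[leLHS]addr0; apply: lerD; last first.
    by apply: sumr_ge0 => i _; case: ifP => _; rewrite ?powR_ge0.
  rewrite (bigD1 j)//= -[leLHS]addr0; apply: lerD; last first.
    by apply: sumr_ge0 => i _; case: ifP => _; rewrite ?powR_ge0.
  rewrite /F insubT//= => jk.
  rewrite (_ : Sub _ _ = j) ?eqxx; last exact: val_inj.
  apply: (le_trans target); apply: (@le_trans _ _ (k%:R `^ (- p))).
    by rewrite -[leRHS]mul1r ler_wpM2r ?powR_ge0//; lra.
  by apply: ler_powRN => //; rewrite ler_nat.
rewrite -[rshift _ _]/(unsplit (inr b')) unsplitK => good.
rewrite -[leLHS]add0r; apply: lerD.
  by apply: sumr_ge0 => i _; case: ifP => _; rewrite ?powR_ge0.
apply: (le_trans target); apply: (le_trans good); rewrite big_mkcond/=.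
apply: ler_sum => i _.
rewrite /F insubF ?addKn; last by rewrite ltnNge leq_addr.
by rewrite (inj_eq (@rshift_inj _ _)).
Qed.
End covering.

(** * A uniform variable on an atomless space *)

Section atomless_space.
Context (R : realType) (d : measure_display) (T : measurableType d).
Context (P : probability T R).

Local Notation pr A := (fine (P A)).

Lemma EFin_prob (A : set T) : measurable A -> P A = (pr A)%:E.
Proof. by move=> mA; rewrite fineK// fin_num_measure. Qed.

Lemma pr_le (A B : set T) : measurable A -> measurable B -> A `<=` B ->
  pr A <= pr B.
Proof.
by move=> mA mB AB; rewrite fine_le ?fin_num_measure// le_measure ?inE.
Qed.

Lemma pr_setD (A B : set T) : measurable A -> measurable B -> A `<=` B ->
  pr (B `\` A) = pr B - pr A.
Proof.
move=> mA mB AB.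
have PB : (P B < +oo)%E by rewrite (EFin_prob mB) ltry.
by rewrite (measureD mB mA PB) (setIidr AB) fineB ?fin_num_measure.
Qed.

Lemma pr_setU (A B : set T) : measurable A -> measurable B -> A `&` B = set0 ->
  pr (A `|` B) = pr A + pr B.
Proof.
by move=> mA mB AB; rewrite measureU// fineD ?fin_num_measure.
Qed.

Context (hP : atomless P).

Lemma atomless_halve (A : set T) : measurable A -> 0 < pr A ->
  exists B, [/\ measurable B, B `<=` A & 0 < pr B <= pr A / 2].
Proof.
move=> mA A0; have [|B [mB BA B0 BltA]] := hP mA.
  by rewrite (EFin_prob mA) lte_fin.
move: B0 BltA; rewrite (EFin_prob mA) (EFin_prob mB) !lte_fin => B0 BltA.
have [le|lt] := leP (pr B) (pr A / 2).
  by exists B; rewrite B0.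
exists (A `\` B); split; [exact: measurableD|by move=> x []|].
rewrite pr_setD//; lra.
Qed.

Lemma atomless_small (A : set T) (e : R) : measurable A -> 0 < pr A -> 0 < e ->
  exists B, [/\ measurable B, B `<=` A & 0 < pr B < e].
Proof.
move=> mA A0 e0.
have small n :
    exists B, [/\ measurable B, B `<=` A & 0 < pr B <= pr A / 2 ^+ n].
  elim: n => [|n [B [mB BA /andP[B0 Bn]]]].
    by exists A; split => //; rewrite A0 expr0 divr1 lexx.
  have [C [mC CB /andP[C0 CleB]]] := atomless_halve mB B0.
  exists C; split => //; first exact: subset_trans BA.
  rewrite C0 (le_trans CleB)// exprS invfM mulrCA mulrC ler_wpM2l//.
have [B [mB BA /andP[B0 Bn]]] := small (Num.bound (pr A / e)).
exists B; split => //; rewrite B0 (le_lt_trans Bn)//.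
rewrite ltr_pdivrMr ?exprn_gt0// mulrC -ltr_pdivrMr//.
exact: (@upper_nthrootP R).
Qed.

(** One step of the exhaustion argument: [D] takes at least half of what can
    still be added to [C] inside [A] without exceeding [t]. *)
Lemma atomless_fill_step (A C : set T) (t : R) :
  measurable A -> measurable C -> C `<=` A -> pr C <= t ->
  exists D, [/\ measurable D, C `<=` D, D `<=` A, pr D <= t &
    forall E, measurable E -> C `<=` E -> E `<=` A -> pr E <= t ->
      pr E - pr C <= 2 * (pr D - pr C)].
Proof.
move=> mA mC CA Ct.
pose S := [set x : R | exists D : set T,
  [/\ measurable D, C `<=` D, D `<=` A, pr D <= t & x = pr D]].
have SC : S (pr C) by exists C; split.
have ubS : has_ubound S by exists t => x [D [_ _ _ ? ->]].
have [/eqP eqC|neqC] := boolP (pr C == sup S).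
  exists C; split => // E mE CE EA Et.
  rewrite subrr mulr0 subr_le0 eqC; apply: ub_le_sup => //.
  by exists E.
have ltC : pr C < sup S by rewrite lt_neqAle neqC; exact: ub_le_sup.
have [||x Sx ltx] := @sup_adherent R S ((sup S - pr C) / 2).
- by rewrite divr_gt0// subr_gt0.
- by split => //; exists (pr C).
case: Sx ltx => D [mD CD DA Dt ->] ltD.
exists D; split => // E mE CE EA Et.
have : pr E <= sup S by apply: ub_le_sup => //; exists E.
lra.
Qed.

(** Sierpinski's theorem.  If the union of the exhausting sequence missed [t],
    a small set [D] could be added at every step, and every step would add at
    least half of the probability of [D], which is impossible infinitely
    often. *)
Lemma atomless_subset (A : set T) (t : R) : measurable A -> 0 <= t <= pr A ->
  exists B, [/\ measurable B, B `<=` A & pr B = t].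
Proof.
move=> mA /andP[t0 tA].
have step (C : set T) : exists D, measurable C -> C `<=` A -> pr C <= t ->
  [/\ measurable D, C `<=` D, D `<=` A, pr D <= t &
    forall E, measurable E -> C `<=` E -> E `<=` A -> pr E <= t ->
      pr E - pr C <= 2 * (pr D - pr C)].
  have [mC|?] := pselect (measurable C); last by exists C.
  have [CA|?] := pselect (C `<=` A); last by exists C.
  have [Ct|tC] := leP (pr C) t; last by exists C => _ _; rewrite leNgt tC.
  by have [D ?] := atomless_fill_step mA mC CA Ct; exists D.
have [f fP] := choice step.
pose C n := iter n f set0.
have CP n : [/\ measurable (C n), C n `<=` A & pr (C n) <= t].
  elim: n => [|n [mC CA Ct]].
    by rewrite /C/= measure0; split => //; exact: sub0set.
  by have [] := fP _ mC CA Ct.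
have CS n : C n `<=` C n.+1.
  by have [mC CA Ct] := CP n; have [] := fP _ mC CA Ct.
have Chomo : {homo C : n m / (n <= m)%N >-> (n <= m)%O}.
  apply: homo_leq; [by []|exact: le_trans|].
  by move=> n; rewrite subsetEset.
have mC n : measurable (C n) by have [] := CP n.
have mCU : measurable (\bigcup_n C n) by exact: bigcupT_measurable.
exists (\bigcup_n C n); split => //.
  by move=> w [n _]; have [_ + _] := CP n; exact.
have CUt : pr (\bigcup_n C n) <= t.
  rewrite -lee_fin -EFin_prob//.
  have cv : P \o C @ \oo --> P (\bigcup_n C n).
    exact: nondecreasing_cvg_mu.
  apply: (cvge_to_le cv); near=> n => /=.
  by rewrite EFin_prob// lee_fin; have [] := CP n.
apply/eqP; rewrite eq_le CUt /= leNgt; apply/negP => ltt.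
have CUA : \bigcup_n C n `<=` A by move=> w [n _]; have [_ + _] := CP n; exact.
have [|||D [mD DAC /andP[D0 Dt]]] :=
  @atomless_small (A `\` \bigcup_n C n) (t - pr (\bigcup_n C n)).
- exact: measurableD.
- by rewrite pr_setD// subr_gt0 (lt_le_trans ltt).
- by rewrite subr_gt0.
have DC n : C n `&` D = set0.
  apply/seteqP; split => // w [Cw /DAC[_]]; apply.
  by exists n.
have gap n : pr D <= 2 * (pr (C n.+1) - pr (C n)).
  have [mCn CA Ct] := CP n; have [_ _ _ _ /(_ (C n `|` D))] := fP _ mCn CA Ct.
  rewrite pr_setU// addrAC subrr add0r; apply.
  - exact: measurableU.
  - by move=> w; left.
  - by move=> w [/CA//|/DAC[]].
  - have : pr (C n) <= pr (\bigcup_n C n) by apply: pr_le => // w ?; exists n.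
    lra.
have grow n : n%:R * pr D <= 2 * pr (C n).
  elim: n => [|n IH]; first by rewrite /C/= measure0 mul0r mulr0.
  by have := gap n; rewrite -natr1; lra.
have /archi_boundP : 0 <= 2 * t / pr D by rewrite divr_ge0 ?mulr_ge0 ?(ltW D0).
rewrite ltr_pdivrMr// ltNge.
rewrite (le_trans (grow _))// ler_wpM2l//.
by have [] := CP (Num.bound (2 * t / pr D)).
Unshelve. all: by end_near. Qed.

Lemma atomless_midpoint (A B : set T) : measurable A -> measurable B ->
  A `<=` B -> exists C, [/\ measurable C, A `<=` C, C `<=` B &
                            pr C = (pr A + pr B) / 2].
Proof.
move=> mA mB AB; have mBA := measurableD mB mA.
have le := pr_le mA mB AB.
have [|D [mD DBA prD]] := @atomless_subset (B `\` A) ((pr B - pr A) / 2) mBA.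
  rewrite pr_setD//; lra.
exists (A `|` D); split.
- exact: measurableU.
- by move=> w; left.
- by move=> w [/AB//|/DBA[]].
- rewrite pr_setU ?prD; [lra|by []|by []|].
  by apply/seteqP; split => // w [Aw /DBA[]].
Qed.

End atomless_space.

Section uniform_existence.
Context (R : realType) (d : measure_display) (T : measurableType d).
Context (P : probability T R) (hP : atomless P).

Local Notation pr A := (fine (P A)).

(** [C n k] has probability [k / 2 ^ n] and depends on this number only.  Level
    [n.+1] inserts a set of intermediate probability between any two
    neighbours of level [n]; the indices [k > 2 ^ n] stand for the whole
    space. *)
Lemma dyadic_chain : exists C : nat -> nat -> set T,
  [/\ forall n k, measurable (C n k),
      forall n k n' k', (k * 2 ^ n' <= k' * 2 ^ n)%N -> C n k `<=` C n' k',
      forall n k, (k <= 2 ^ n)%N -> pr (C n k) = k%:R / 2 ^+ n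
    & C 0 0 = set0 /\ C 0 1 = setT].
Proof.
have mid (AB : set T * set T) : exists C, measurable AB.1 -> measurable AB.2 ->
    AB.1 `<=` AB.2 -> [/\ measurable C, AB.1 `<=` C, C `<=` AB.2 &
                      pr C = (pr AB.1 + pr AB.2) / 2].
  have [m1|?] := pselect (measurable AB.1); last by exists setT.
  have [m2|?] := pselect (measurable AB.2); last by exists setT.
  have [s|?] := pselect (AB.1 `<=` AB.2); last by exists setT.
  by have [C ?] := atomless_midpoint hP m1 m2 s; exists C.
have [f fP] := choice mid.
pose C := fix C n k := match n with
  | 0 => if k == 0%N then set0 else setT
  | n'.+1 => if odd k then f (C n' k./2, C n' k./2.+1) else C n' k./2 end.
have CP n : (forall k, measurable (C n k)) /\ (forall k, C n k `<=` C n k.+1).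
  elim: n => [|n [mC sC]].
    split => -[|k] /=.
    - exact: measurable0.
    - exact: measurableT.
    - exact: sub0set.
    - exact: subsetT.
  have F k := fP (C n k, C n k.+1) (mC _) (mC _) (sC _).
  split => k /=; first by case: ifP => _ //; have [] := F k./2.
  rewrite uphalf_half; case: ifP => ok /=.
    by have [] := F k./2.
  by rewrite add0n; have [] := F k./2.
have mC n k : measurable (C n k) by have [] := CP n.
have sC n : {homo C n : j k / (j <= k)%N >-> j `<=` k}.
  apply: homo_leq; [by move=> A w|by move=> A B D; exact: subset_trans|].
  by have [] := CP n.
have C2 m n k : C (n + m)%N (k * 2 ^ m)%N = C n k.
  elim: m => [|m IH]; first by rewrite addn0 expn0 muln1.
  by rewrite addnS expnS mulnCA mul2n /= odd_double doubleK.
exists C; split => //.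
  move=> n k n' k' le w.
  rewrite -(C2 n' n k) -(C2 n n' k') [in X in _ -> X]addnC.
  exact: sC.
elim=> [|n IH] k kn.
  move: kn; rewrite expn0 expr0 divr1.
  by case: k => [|[|//]] _ /=; rewrite ?measure0 ?probability_setT.
have kh : (k./2 <= 2 ^ n)%N by rewrite -[leqRHS]doubleK -mul2n -expnS half_leq.
have k2 := odd_double_half k.
rewrite /=; case: ifP k2 => ok /= k2; last first.
  rewrite IH// exprS -[in RHS]k2 add0n -muln2 natrM.
  by field; rewrite expf_neq0.
have kh1 : (k./2.+1 <= 2 ^ n)%N.
  by move: kn; rewrite -[in X in X -> _]k2 expnS mul2n add1n ltn_double.
have [_ _ _ ->] :=
  fP (C n k./2, C n k./2.+1) (mC _ _) (mC _ _) (sC _ _ _ (leqnSn _)).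
rewrite /= !IH// exprS -[in RHS]k2 -muln2 -natr1 natrD natrM.
by field; rewrite expf_neq0.
Qed.

(** The variable is the infimum of the dyadic numbers whose set contains the
    outcome, so that [U w < x] is the union of the sets of index less than
    [x]. *)
Lemma uniform_variable : exists U : T -> R,
  [/\ measurable_fun setT U, forall w, 0 <= U w < 1 &
      forall x, 0 <= x <= 1 -> pr [set w | U w < x] = x].
Proof.
have [C [mC sC prC [C00 C01]]] := dyadic_chain.
pose S w := [set x : R | exists n k, C n k w /\ x = k%:R / 2 ^+ n].
pose U w := inf (S w).
have lbS w : has_lbound (S w).
  by exists 0 => x [n [k [_ ->]]]; rewrite divr_ge0// exprn_ge0.
have S1 w : S w 1 by exists 0%N, 1%N; rewrite C01 expr0 divr1.
have U0 w : 0 <= U w.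
  apply: lb_le_inf; first by exists 1.
  by move=> x [n [k [_ ->]]]; rewrite divr_ge0// exprn_ge0.
have U1 w : U w <= 1 by apply: ge_inf.
have UE (x : R) : [set w | U w < x] =
    \bigcup_n \bigcup_(k in [set k | k%:R / 2 ^+ n < x]) C n k.
  apply/seteqP; split => w /=.
    move=> /inf_lt[|_ [n [k [Cw ->]]] lt]; first by exists 1.
    by exists n => //; exists k.
  move=> [n _ [k /= lt Cw]]; apply: le_lt_trans lt.
  by apply: ge_inf => //; exists n, k.
have mU (x : R) : measurable [set w | U w < x].
  by rewrite UE; apply: bigcupT_measurable => n; exact: bigcup_measurable.
have dyadic_lt (a b : R) : 0 <= a -> a < b ->
    exists n k, a < k%:R / 2 ^+ n < b.
  move=> a0 ab; pose n := Num.bound (b - a)^-1.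
  have n0 : 0 < 2 ^+ n :> R by rewrite exprn_gt0.
  have ltn : (b - a)^-1 < 2 ^+ n by exact: (@upper_nthrootP R).
  exists n, (Num.trunc (a * 2 ^+ n)).+1.
  have /andP[le lt] := truncn_itv (mulr_ge0 a0 (ltW n0)).
  rewrite ltr_pdivlMr// lt /= ltr_pdivrMr// -natr1.
  apply: (le_lt_trans (lerD le (lexx _))).
  rewrite -ltrBrDl -mulrBl mulrC -ltr_pdivrMr ?subr_gt0//.
  by rewrite div1r.
have dyadic_le (n k : nat) : k%:R / 2 ^+ n <= 1 :> R -> (k <= 2 ^ n)%N.
  by rewrite ler_pdivrMr ?exprn_gt0// mul1r -natrX ler_nat.
have cdfU (x : R) : 0 <= x <= 1 -> pr [set w | U w < x] = x.
  move=> /andP[x0 x1]; apply/eqP; rewrite eq_le; apply/andP; split.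
    have [->|xlt1] := eqVneq x 1.
      by rewrite -lee_fin -EFin_prob// probability_le1.
    rewrite leNgt; apply/negP => ltp.
    have [|n [k /andP[xk kp]]] :=
      dyadic_lt x (Num.min 1 (pr [set w | U w < x])) x0.
      by rewrite lt_min ltp andbT lt_neqAle xlt1.
    move: kp; rewrite lt_min => /andP[k1 kp].
    move: kp; rewrite -prC ?dyadic_le ?(ltW k1)// ltNge pr_le//.
    rewrite UE => w [n' _ [k' /= lt']]; apply: sC.
    rewrite -(ler_nat R) !natrM !natrX -ler_pdivrMr ?exprn_gt0// mulrAC.
    by rewrite -ler_pdivlMr ?exprn_gt0// ltW// (lt_trans lt').
  rewrite leNgt; apply/negP => ltp.
  have p0 : 0 <= pr [set w | U w < x] by rewrite fine_ge0.
  have [n [k /andP[pk kx]]] := dyadic_lt _ _ p0 ltp.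
  move: pk; rewrite -prC ?dyadic_le ?(ltW (lt_le_trans kx x1))// ltNge pr_le//.
  by rewrite UE => w Cw; exists n => //; exists k.
(* The value 1 is attained on a null set only; removing it makes the cell
   number of an outcome well defined. *)
pose V w := if U w < 1 then U w else 0.
have VE (x : R) : 0 < x <= 1 ->
    [set w | V w < x] = [set w | U w < x] `|` ~` [set w | U w < 1].
  move=> /andP[x0 x1]; apply/seteqP; split => w /=; rewrite /V.
    by case: ifPn => [_ ?|lt _]; [left|right; exact/negP].
  by case: ifPn => [lt [//|/(_ isT)]//|? _].
have V01 w : 0 <= V w < 1.
  by rewrite /V; case: ifPn => [->|]; rewrite ?U0 ?lexx ?ltr01.
have V0E (x : R) : x <= 0 -> [set w | V w < x] = set0.
  move=> x0; apply/seteqP; split => // w /= /lt_le_trans/(_ x0).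
  by rewrite ltNge; have /andP[->] := V01 w.
exists V; split => //.
  apply: (measurability _ (measurable_realfun.RGenInftyO.measurableE R)).
  move=> /= _ [_ [x ->] <-].
  rewrite setTI [X in measurable X](_ : _ = [set w | V w < x]); last first.
    by apply/seteqP; split => w /=; rewrite in_itv.
  have [x0|x0] := leP x 0; first by rewrite V0E.
  have [x1|x1] := leP x 1.
    by rewrite VE ?x0//; apply: measurableU => //; exact: measurableC.
  rewrite (_ : [set w | _] = setT)//; apply/seteqP; split => w //= _.
  by have /andP[_ /lt_trans] := V01 w; apply.
move=> x /andP[x0 x1]; have [->|xn0] := eqVneq x 0.
  by rewrite V0E// measure0.
rewrite VE ?lt_neqAle ?x0 ?x1 ?andbT 1?eq_sym// pr_setU//.
- rewrite -setTD pr_setD// probability_setT cdfU ?x0// cdfU ?lexx ?ler01//=.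
  by rewrite subrr addr0.
- exact: measurableC.
- apply/seteqP; split => // w [/= lt []]; exact: lt_le_trans x1.
Qed.

End uniform_existence.

(** * Rearrangements of a uniform variable *)

Lemma uniform_prob_ray (R : realType) (b : bool) (x : R) : 0 <= x <= 1 ->
  uniform_prob (@ltr01 R) [set` Interval -oo%O (BSide b x)] = x%:E.
Proof.
move=> /andP[x0 x1]; rewrite /uniform_prob integral_uniform_pdf.
rewrite (_ : _ `&` _ = [set` Interval (BLeft 0) (BSide b x)]); last first.
  apply/seteqP; split => y; rewrite /= !in_itv/=.
    by move=> [-> /andP[->]].
  move=> /andP[-> yx]; split=> //=.
  by case: b yx => /= [/ltW|] /le_trans; exact.
rewrite (eq_integral (fun=> 1%E)) => [|y]; last first.
  rewrite inE/= in_itv/= => /andP[y0 yx]; rewrite /uniform_pdf y0 subr0 invr1.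
  by case: ifPn => // /negP[]; case: b yx => /= [/ltW|] /le_trans; exact.
rewrite integral_cst//= mul1e lebesgue_measure_itv/= lte_fin.
have [->|xn0] := eqVneq x 0; first by rewrite ltxx.
by rewrite lt_neqAle eq_sym xn0 x0 sube0.
Qed.

Section interval_exchange.
Context (R : realType) (d : measure_display) (T : measurableType d).
Context (P : probability T R).

Local Notation pr A := (fine (P A)).

Lemma uniform01_cdf (X : {RV P >-> R}) : (forall w, 0 <= X w < 1) ->
  (forall x, 0 <= x <= 1 -> pr [set w | X w < x] = x) -> uniform01 X.
Proof.
move=> X01 cdfX A mA.
pose G := [set A | exists x : R, A = `]-oo, x[%classic].
have XE (x : R) : X @^-1` `]-oo, x[%classic = [set w | X w < x].
  by apply/seteqP; split => w /=; rewrite in_itv.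
(* The law [uniform_prob] lives on [measurableTypeR R], another copy of the
   Borel structure of [R]. *)
have mX : measurable_fun setT (X : T -> measurableTypeR R).
  exact: (@measurable_funPT _ _ _ _ X).
pose X' : {mfun T >-> measurableTypeR R} :=
  HB.pack (X : T -> measurableTypeR R) (isMeasurableFun.Build _ _ _ _ _ mX).
pose m1 : {measure set (measurableTypeR R) -> \bar R} := distribution P X'.
pose m2 : {measure set (measurableTypeR R) -> \bar R} :=
  uniform_prob (@ltr01 R).
change (m1 A = m2 A).
apply: (@measure_unique _ R (measurableTypeR R) G
  (fun n => `]-oo, n%:R[%classic) _ _ _ _ m1 m2) => //=.
- exact: measurable_realfun.RGenInftyO.measurableE.
- move=> _ _ [x ->] [y ->]; exists (Num.min x y).
  apply/seteqP; split => z /=; rewrite !in_itv/= lt_min; last by move=> /andP.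
  by move=> [-> ->].
- by move=> n; exists n%:R.
- apply/seteqP; split => // x _; exists (Num.bound `|x|) => //=.
  by rewrite in_itv/= (le_lt_trans (ler_norm _))// archi_boundP.
- move=> _ [x ->]; rewrite /distribution/= /pushforward XE.
  have [x0|x0] := leP x 0.
    rewrite (_ : [set w | _] = set0) ?measure0; last first.
      apply/seteqP; split => // w /= /lt_le_trans/(_ x0).
      by rewrite ltNge; have /andP[->] := X01 w.
    apply/esym/eqP; rewrite -measure_le0.
    rewrite -[leRHS](uniform_prob_ray true (x := 0)) ?lexx ?ler01//.
    rewrite le_measure ?inE//.
    by move=> y /=; rewrite !in_itv/= => /lt_le_trans; exact.
  have [x1|x1] := leP x 1.
    rewrite EFin_prob ?cdfX ?uniform_prob_ray ?(ltW x0)//.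
    by rewrite -XE -[X in measurable X]setTI; exact: measurable_funP.
  rewrite (_ : [set w | _] = setT) ?probability_setT; last first.
    apply/seteqP; split => // w _ /=.
    by have /andP[_ /lt_trans] := X01 w; apply.
  apply/eqP; rewrite eq_le probability_le1 ?andbT//.
  rewrite -[leLHS](uniform_prob_ray true (x := 1)) ?lexx ?ler01//.
  rewrite le_measure ?inE//.
  by move=> y /=; rewrite !in_itv/= => /lt_trans; exact.
- by move=> k; rewrite (le_lt_trans (probability_le1 _ _)) ?ltry.
Qed.

(** Interval exchanges of a uniform variable [V].  [X s] moves the cell of
    length [1 / N] containing [V] to the cell with number [s (cell w)] and
    keeps the position inside it.  The probability of [X s < x] is a sum over
    the cells whose terms depend only on [s j], so a reindexing by [s] reduces
    it to the case of the identity, where [X] is [V]. *)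
Lemma uniform_shuffles (N : nat) : (0 < N)%N -> atomless P ->
  exists (cell : T -> 'I_N) (X : {perm 'I_N} -> {RV P >-> R}),
  [/\ forall s, uniform01 (X s),
      forall (s : {perm 'I_N}) w,
        (s (cell w))%:R / N%:R <= X s w < (s (cell w)).+1%:R / N%:R,
      forall A : pred 'I_N, measurable [set w | A (cell w)]
    & forall A : pred 'I_N, pr [set w | A (cell w)] = #|A|%:R / N%:R].
Proof.
case: N => // N _ hP; have [V [mV V01 cdfV]] := uniform_variable hP.
have [n nE] : exists n : R, n = N.+1%:R by exists N.+1%:R.
have n0 : 0 < n by rewrite nE ltr0n.
rewrite -nE.
have mlt (x : R) : measurable [set w | V w < x].
  rewrite (_ : [set w | _] = V @^-1` `]-oo, x[%classic).
    by rewrite -[X in measurable X]setTI; exact: mV.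
  by apply/seteqP; split => w /=; rewrite in_itv.
pose slice a b := [set w | a <= V w < b].
have sliceE a b : slice a b = [set w | V w < b] `\` [set w | V w < a].
  apply/seteqP; split => w /=; rewrite /slice/= leNgt.
    by move=> /andP[/negP ? ?].
  by move=> [-> /negP ->].
have mslice a b : measurable (slice a b) by rewrite sliceE; exact: measurableD.
have pslice a b : 0 <= a <= 1 -> b <= 1 -> pr (slice a b) = Num.max 0 (b - a).
  move=> /andP[a0 a1] b1; have [ba|ab] := leP b a.
    rewrite max_l ?subr_le0// (_ : slice a b = set0) ?measure0//.
    apply/seteqP; split => // w /=.
    by rewrite /slice/= => /andP[/le_lt_trans/[apply]]; rewrite ltNge ba.
  rewrite max_r ?subr_ge0 ?(ltW ab)// sliceE pr_setD//; last first.
    by move=> w /= /lt_trans; exact.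
  by rewrite !cdfV ?a0 ?a1 ?b1 ?(le_trans a0 (ltW ab)).
have [cell cellV] : exists cell : T -> 'I_N.+1,
    forall w, (cell w)%:R <= n * V w < (cell w).+1%:R.
  exists (fun w => inord (Num.trunc (n * V w))) => w.
  have /andP[V0 V1] := V01 w; have nV0 : 0 <= n * V w by rewrite mulr_ge0// ltW.
  by rewrite inordK ?truncn_itv// truncn_lt_nat// -nE -[ltRHS]mulr1 ltr_pM2l.
have cellP w (j : 'I_N.+1) : cell w = j <-> j%:R / n <= V w < j.+1%:R / n.
  rewrite ler_pdivrMr// ltr_pdivlMr// mulrC; split => [<-|/andP[jV Vj]]//.
  have /andP[cV Vc] := cellV w; apply/val_inj/eqP.
  rewrite eqn_leq -ltnS -(ltr_nat R) (le_lt_trans cV)//=.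
  by rewrite -ltnS -(ltr_nat R) (le_lt_trans jV).
have cellE (j : 'I_N.+1) :
    [set w | cell w = j] = slice (j%:R / n) (j.+1%:R / n).
  by apply/seteqP; split => w /cellP.
have jn01 (j : 'I_N.+1) : 0 <= j%:R / n <= 1.
  by rewrite divr_ge0 ?(ltW n0)//= ler_pdivrMr// mul1r nE ler_nat ltnW.
have jn1 (j : 'I_N.+1) : j.+1%:R / n <= 1.
  by rewrite ler_pdivrMr// mul1r nE ler_nat.
pose X (s : {perm 'I_N.+1}) w :=
  ((s (cell w))%:R + (n * V w - (cell w)%:R)) / n.
(* On the cell [j], [X s < x] means [V < x + (j - s j) / n]. *)
pose b (s : {perm _}) (x : R) (j : 'I_N.+1) :=
  Num.min (j.+1%:R / n) (x + (j%:R - (s j)%:R) / n).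
have XE s (x : R) : [set w | X s w < x] =
    \big[setU/set0]_(j < N.+1) slice (j%:R / n) (b s x j).
  rewrite -bigcup_mkord_ord; apply/seteqP; split => w.
    move=> /= Xx; exists (cell w); first exact: ltn_ord.
    have [/(_ erefl)/andP[cV Vc] _] := cellP w (cell w).
    rewrite inord_val /slice/b/= cV lt_min Vc/=.
    move: Xx; rewrite /X mulrDl !mulrBl [n * _]mulrC mulfK ?gt_eqF//; lra.
  move=> [j /= jN]; rewrite /slice/b/= lt_min => /and3P[jV Vj Vx].
  have := cellP w (inord j); rewrite jV Vj => -[_ /(_ isT) cj].
  move: Vx; rewrite /= /X cj !mulrDl !mulNr [n * _]mulrC mulfK ?gt_eqF//; lra.
have mXlt s (x : R) : measurable [set w | X s w < x].
  by rewrite XE; exact: bigsetU_measurable.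
have mX s : measurable_fun setT (X s).
  apply: (measurability _ (measurable_realfun.RGenInftyO.measurableE R)).
  move=> /= _ [_ [x ->] <-].
  rewrite setTI [X in measurable X](_ : _ = [set w | X s w < x]).
    exact: mXlt.
  by apply/seteqP; split => w /=; rewrite in_itv.
pose h (x : R) (k : nat) := Num.max 0 (Num.min n^-1 (x - k%:R / n)).
have prX s x : 0 <= x <= 1 ->
    pr [set w | X s w < x] = \sum_(j < N.+1) h x (s j).
  move=> /andP[x0 x1].
  rewrite XE measure_semi_additive_ord//; last 2 first.
  - apply/trivIsetP => i j _ _ ij; apply/seteqP; split => // w [].
    rewrite /slice /b /= !lt_min => /and3P[iV Vi _] /and3P[jV Vj _].
    have [_ /(_ _)] := cellP w i; rewrite iV Vi => /(_ isT) ci.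
    have [_ /(_ _)] := cellP w j; rewrite jV Vj => /(_ isT) cj.
    by move: ij; rewrite -ci -cj eqxx.
  - by apply: bigsetU_measurable.
  have pE (j : 'I_N.+1) : P (slice (j%:R / n) (b s x j)) = (h x (s j))%:E.
    rewrite EFin_prob// pslice// ?ge_min ?jn1//.
    congr (Num.max 0 _)%:E; rewrite /b addr_minl -natr1 !mulrDl mul1r mulNr.
    by congr Num.min; lra.
  rewrite (eq_bigr (fun j => (h x (s j))%:E)) ?sumEFin// => j _; exact: pE.
have X1V w : X 1%g w = V w.
  by rewrite /X perm1 addrC subrK mulrAC divff ?mul1r// gt_eqF.
have cdfX s x : 0 <= x <= 1 -> pr [set w | X s w < x] = x.
  move=> x01; rewrite prX// -[RHS]cdfV//.
  transitivity (pr [set w | X 1%g w < x]); last by under eq_set do rewrite X1V.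
  rewrite prX// [RHS](reindex_inj (@perm_inj _ s)).
  by apply: eq_bigr => j _; rewrite perm1.
have Xcell (s : {perm _}) w :
    (s (cell w))%:R / n <= X s w < (s (cell w)).+1%:R / n.
  rewrite /X ler_pM2r ?invr_gt0// ltr_pM2r ?invr_gt0// -natr1.
  by have := cellV w; rewrite -natr1; lra.
have cellA (A : pred 'I_N.+1) : [set w | A (cell w)] =
    \big[setU/set0]_(j in A) [set w | cell w = j].
  rewrite -bigcup_pred; apply/seteqP; split => w /= => [?|[j jA cj]].
    by exists (cell w).
  by rewrite cj.
pose XRV s : {RV P >-> R} :=
  HB.pack (X s) (isMeasurableFun.Build _ _ _ _ _ (mX s)).
exists cell, XRV; split => //.
- move=> s; apply: uniform01_cdf => [w|x]; last exact: cdfX.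
  have /andP[cX Xc] := Xcell s w; have /andP[s0 _] := jn01 (s (cell w)).
  by rewrite (le_trans s0 cX) (lt_le_trans Xc).
- by move=> A; rewrite cellA; apply: bigsetU_measurable => j _; rewrite cellE.
move=> A; rewrite cellA measure_bigsetU_ord; last 2 first.
- by move=> j; rewrite cellE.
- apply/trivIsetP => i j _ _ ij; apply/seteqP; split => // w [/= ci cj].
  by move: ij; rewrite -ci -cj eqxx.
rewrite (eq_bigr (fun=> (n^-1)%:E)) => [|j _].
  by rewrite sumEFin/= sumr_const mulr_natl.
rewrite cellE.
change (P (slice (j%:R / n) (j.+1%:R / n)) = n^-1%:E).
rewrite EFin_prob// pslice// max_r -mulrBl -natr1 addrC addKr ?mul1r//.
by rewrite invr_ge0 ltW.
Qed.
End interval_exchange.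

(** The [n * K] cells are numbered row by row in an array with [n] rows of [K]
    slots.  The map [f] assigns the cell [t], for [t < K], to the row [f t],
    and that cell is to appear in slot [t] of that row: the transposition of
    the rows [0] and [f t] in slot [t] does this.  Column [i] reads the slots
    of a row after a cyclic shift by [i], so that on a given row every cell of
    the row is met by exactly one column, while each column runs once through
    all cells. *)
Section arrangement.
Context (n K : nat) (n0 : (0 < n)%N) (K0 : (0 < K)%N) (f : 'I_K -> 'I_n).

Fact grid_row_subproof (j : 'I_(n * K)) : (j %/ K < n)%N.
Proof. by rewrite ltn_divLR. Qed.
Definition grid_row j : 'I_n := Ordinal (grid_row_subproof j).

Definition grid_slot (i : 'I_K) (j : 'I_(n * K)) : 'I_K :=
  Ordinal (ltn_pmod (j + i) K0).

Fact arrange_subproof (i : 'I_K) (j : 'I_(n * K)) :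
  (tperm (Ordinal n0) (f (grid_slot i j)) (grid_row j) * K + grid_slot i j
     < n * K)%N.
Proof.
set g := tperm _ _ _; set t := grid_slot _ _.
by rewrite (@leq_trans (g.+1 * K)%N) ?leq_pmul2r// mulSn addnC ltn_add2r.
Qed.
Definition arrange i j := Ordinal (arrange_subproof i j).

Lemma arrange_inj i : injective (arrange i).
Proof.
move=> j j' /(congr1 val) eqv.
have eq : (tperm (Ordinal n0) (f (grid_slot i j)) (grid_row j) * K +
    grid_slot i j =
  tperm (Ordinal n0) (f (grid_slot i j')) (grid_row j') * K +
    grid_slot i j')%N := eqv.
have slot_eq : grid_slot i j = grid_slot i j'.
  apply/val_inj => /=; move: (congr1 (modn^~ K) eq).
  by rewrite /= !modnMDl !modn_mod.
move: eq; rewrite slot_eq => /eqP; rewrite eqn_add2r eqn_pmul2r//.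
move=> /eqP/val_inj/perm_inj row_eq.
apply/val_inj; rewrite /= (divn_eq j K) (divn_eq j' K).
have -> : (j %/ K = j' %/ K)%N := congr1 val row_eq.
congr addn; apply/eqP; move: (congr1 val slot_eq) => /= /eqP.
by rewrite eqn_modDr.
Qed.

Lemma arrange_meet (j : 'I_(n * K)) : exists2 col : 'I_K -> 'I_K,
  injective col & forall t, f t = grid_row j -> val (arrange (col t) j) = t.
Proof.
pose col (t : 'I_K) : 'I_K := Ordinal (ltn_pmod (t + (K - j %% K)) K0).
have slotE t : grid_slot (col t) j = t.
  apply/val_inj; rewrite /= modnDmr addnCA -modnDmr -(modnDml j).
  by rewrite subnKC 1?ltnW ?ltn_pmod// modnn addn0 modn_small.
exists col => [t t' tt'|t ft]; first by rewrite -(slotE t) tt' slotE.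
change (tperm (Ordinal n0) (f (grid_slot (col t) j)) (grid_row j) * K +
  grid_slot (col t) j = t)%N.
by rewrite slotE ft tpermR.
Qed.

Lemma card_grid_row (A : pred 'I_n) :
  #|[pred j | A (grid_row j)]| = (#|A| * K)%N.
Proof.
have gP (p : 'I_n * 'I_K) : (p.1 * K + p.2 < n * K)%N.
  by rewrite (@leq_trans (p.1.+1 * K)%N) ?leq_pmul2r// mulSn addnC ltn_add2r.
pose h p := Ordinal (gP p).
have hK : bijective h.
  exists (fun j => (grid_row j, Ordinal (ltn_pmod j K0))) => [[g s]|j].
    congr pair; apply/val_inj => /=.
      by rewrite divnMDl// divn_small// addn0.
    by rewrite modnMDl modn_small.
  by apply/val_inj; rewrite /= -divn_eq.
rewrite -sum1_card (reindex h)/=; last exact: onW_bij.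
rewrite (eq_bigl (fun p => A p.1 && true)) => [|[g s]]; last first.
  rewrite andbT inE /=; congr (A _); apply/val_inj => /=.
  by rewrite divnMDl// divn_small// addn0.
rewrite -(pair_big A xpredT (fun _ _ => 1%N))/=.
by rewrite sum_nat_const sum1_card card_ord.
Qed.

End arrangement.

(** [row w] is uniform on the rows, and whatever the row, some column visits
    the cell [t] of each [t] dealt to this row. *)
Lemma uniform_arrangement (R : realType) (d : measure_display)
    (T : measurableType d) (P : probability T R) (n K : nat)
    (f : 'I_K -> 'I_n) : atomless P -> (0 < n)%N -> (0 < K)%N ->
  exists (U : 'I_K -> {RV P >-> R}) (row : T -> 'I_n),
  [/\ forall i, uniform01 (U i), forall i w, 0 <= U i w <= 1,
      forall A : pred 'I_n, measurable [set w | A (row w)] /\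
        P [set w | A (row w)] = (#|A|%:R / n%:R)%:E
    & forall w, exists2 col : 'I_K -> 'I_K, injective col &
        forall t, f t = row w -> U (col t) w <= t.+1%:R / (n%:R * K%:R)].
Proof.
move=> hP n0 K0; have nK0 : (0 < n * K)%N by rewrite muln_gt0 n0.
have [cell [X [unifX Xcell mcell pcell]]] := uniform_shuffles nK0 hP.
have nK0R : 0 < n%:R * K%:R :> R by rewrite mulr_gt0 ?ltr0n.
pose s i := perm (@arrange_inj n K n0 K0 f i).
exists (X \o s), (fun w => grid_row K0 (cell w)); split => [i|i w|A|w].
- exact: unifX.
- have /andP[lo up] := Xcell (s i) w.
  rewrite /= (le_trans _ lo) ?divr_ge0// (le_trans (ltW up))//.
  by rewrite ler_pdivrMr ?ltr0n// mul1r ler_nat.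
- have mA := mcell (fun j => A (grid_row K0 j)); split; first exact: mA.
  rewrite (EFin_prob P mA) (pcell (fun j => A (grid_row K0 j))).
  rewrite card_grid_row// !natrM; congr (_ %:E).
  by rewrite -mulf_div divff ?mulr1// pnatr_eq0 -lt0n.
have [col colI colP] := arrange_meet n0 K0 f (cell w).
exists col => // t ft; have /andP[_ /ltW] := Xcell (s (col t)) w.
by rewrite permE colP// natrM.
Qed.

(** * The scaled means as real functions *)

Section means.
Context (R : realType) (K : nat).
Implicit Types (p q : K.-tuple R) (r : R).

(** On the cube this is [scaled_mean r%:E]: the factor [K `^ (1 + r^-1)] of the
    coefficient and the [K^-1] inside the mean combine to [K]. *)
Definition scaled_power_mean r p : R :=
  if \prod_(i < K) tnth p i == 0 then 0
  else r / (r + 1) * K%:R * (\sum_(i < K) tnth p i `^ r) `^ r^-1.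

(** The initial value 1 bounds the coordinates on the cube and keeps the
    minimum real. *)
Definition scaled_min p : R := K%:R * \big[Num.min/1]_(i < K) tnth p i.

Lemma prod_tnth_neq0 p : unit_cube p -> \prod_(i < K) tnth p i != 0 ->
  forall i, 0 < tnth p i.
Proof.
move=> cp /prodf_neq0 p0 i; rewrite lt_neqAle eq_sym p0//.
by have /andP[] := cp i.
Qed.

Lemma powRVK r (x : R) : r != 0 -> 0 <= x -> (x `^ r^-1) `^ r = x.
Proof. by move=> r0 x0; rewrite -powRrM mulVf// powRr1. Qed.

Lemma sum_powR_gt0 r p : (0 < K)%N -> (forall i, 0 < tnth p i) ->
  0 < \sum_(i < K) tnth p i `^ r.
Proof.
move=> K0 p0; rewrite (bigD1 (Ordinal K0))//= ltr_pwDl ?powR_gt0//.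
by apply: sumr_ge0 => i _; exact: powR_ge0.
Qed.

Lemma scaled_power_mean_le r p (e : R) : r < -1 -> (0 < K)%N -> 0 < e ->
  unit_cube p ->
  (scaled_power_mean r p <= e) =
  (\prod_(i < K) tnth p i == 0) ||
  (((r + 1) / r * e / K%:R) `^ r <= \sum_(i < K) tnth p i `^ r).
Proof.
move=> r1 K0 e0 cp; rewrite /scaled_power_mean.
case: ifPn => [_|/(prod_tnth_neq0 cp) p0]; first exact: ltW.
have S0 := sum_powR_gt0 r K0 p0; set S := \sum_(i < K) _ in S0 *.
have K0R : 0 < K%:R :> R by rewrite ltr0n.
have r0 : r < 0 by lra.
have c0 : 0 < (r + 1) / r by rewrite -mulrNN -invrN divr_gt0//; lra.
have -> : r / (r + 1) = ((r + 1) / r)^-1 by rewrite invf_div.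
have rn0 : r != 0 by rewrite lt_eqF.
rewrite -[X in _ = (_ <= X)](powRVK rn0 (ltW S0)).
rewrite powR_lt0_le ?powR_gt0//; last first.
  by rewrite divr_gt0// mulr_gt0.
by rewrite ler_pdivlMr// -mulrA ler_pdivrMl// mulrC.
Qed.

Lemma power_coef_gt0 r : r < -1 -> 0 < r / (r + 1).
Proof. by move=> r1; rewrite -mulrNN -invrN divr_gt0//; lra. Qed.

Lemma scaled_power_mean_ge0 r p : r < -1 -> 0 <= scaled_power_mean r p.
Proof.
move=> r1; rewrite /scaled_power_mean; case: ifP => // _.
by rewrite mulr_ge0 ?powR_ge0// mulr_ge0// ltW// power_coef_gt0.
Qed.

Lemma scaled_power_mean_nondecreasing r p q : r < -1 -> (0 < K)%N ->
  unit_cube p -> unit_cube q -> (forall i, tnth p i <= tnth q i) ->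
  scaled_power_mean r p <= scaled_power_mean r q.
Proof.
move=> r1 K0 cp cq pq; have r0 : r < 0 by lra.
rewrite {1}/scaled_power_mean; case: ifPn => [_|/(prod_tnth_neq0 cp) p0].
  exact: scaled_power_mean_ge0.
have q0 i : 0 < tnth q i := lt_le_trans (p0 i) (pq i).
have prod0 : (\prod_(i < K) tnth q i == 0) = false.
  by apply/gt_eqF/prodr_gt0 => i _; exact: q0.
rewrite /scaled_power_mean prod0; apply: ler_wpM2l.
  by rewrite mulr_ge0// ltW// power_coef_gt0.
rewrite powR_lt0_le ?invr_lt0 ?sum_powR_gt0//.
by apply: ler_sum => i _; rewrite powR_lt0_le.
Qed.

Lemma measurable_scaled_power_mean r :
  measurable_fun setT (scaled_power_mean r).
Proof.
apply: measurable_fun_ifT => //.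
- apply: measurable_fun_eqr => //.
  by apply: measurable_prod => i _; exact: measurable_tnth.
- apply: measurable_funM => //.
  apply: (measurableT_comp (measurable_powR _)).
  apply: measurable_sum => i.
  apply: (measurableT_comp (measurable_powR _)); exact: measurable_tnth.
Qed.

Lemma scaled_mean_fin r p : r < -1 -> (0 < K)%N -> unit_cube p ->
  scaled_mean r%:E p = scaled_power_mean r p.
Proof.
move=> r1 K0 cp; rewrite /scaled_mean /= /scaled_power_mean.
have K0R : 0 < K%:R :> R by rewrite ltr0n.
have r0 : r < 0 by lra.
case: ifPn => [/prodf_eq0[i _ /eqP pi0]|].
  rewrite (bigD1 i)//= pi0 eqxx addye; last first.
    rewrite gt_eqF// (lt_le_trans (ltNyr 0))// sume_ge0// => j _.
    by case: ifP => // _; rewrite lee_fin powR_ge0.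
  by rewrite gt0_mulye ?lte_fin ?invr_gt0//= mulr0.
move=> /(prod_tnth_neq0 cp) p0.
rewrite (eq_bigr (fun i => (tnth p i `^ r)%:E)) => [|i _]; last first.
  by rewrite gt_eqF.
have S0 := sum_powR_gt0 r K0 p0.
rewrite sumEFin -EFinM/= gt_eqF ?divr_gt0//=.
have powK : K%:R `^ (1 + r^-1) * K%:R^-1 `^ r^-1 = K%:R.
  rewrite powR_invl ?ltW// powRD; last by apply/implyP => _; rewrite gt_eqF.
  by rewrite mulfK ?gt_eqF ?powR_gt0// powRr1 ?ltW.
rewrite powRM ?invr_ge0 ?ltW// -[in RHS]powK; ring.
Qed.

Lemma scaled_mean_Ny p : (0 < K)%N -> unit_cube p ->
  scaled_mean -oo%E p = scaled_min p.
Proof.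
move=> K0 cp; rewrite /scaled_mean /= /scaled_min; congr (_ * _).
rewrite (_ : \big[mine/+oo%E]_(i < K) (tnth p i)%:E =
  (\big[Num.min/1]_(i < K) tnth p i)%:E)//.
have cap (s : seq 'I_K) : mine 1%E (\big[mine/+oo%E]_(i <- s) (tnth p i)%:E) =
    (\big[Num.min/1]_(i <- s) tnth p i)%:E.
  elim: s => [|i s IH]; first by rewrite !big_nil miney.
  by rewrite !big_cons minCA IH EFin_min.
rewrite -cap min_r//.
apply: (bigmin_inf (Ordinal K0)) => //.
by rewrite lee_fin; have /andP[] := cp (Ordinal K0).
Qed.

Lemma scaled_min_le p (e : R) : (0 < K)%N -> e < K%:R ->
  (scaled_min p <= e) = [exists i, tnth p i <= e / K%:R].
Proof.
move=> K0 eK; have K0R : 0 < K%:R :> R by rewrite ltr0n.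
rewrite /scaled_min mulrC -ler_pdivlMr//; apply/bigmin_leP/existsP.
  move=> [|[i _ pi]]; last by exists i.
  by rewrite ler_pdivlMr// mul1r leNgt eK.
by move=> [i pi]; right; exists i.
Qed.

Lemma scaled_min_ge0 p : unit_cube p -> 0 <= scaled_min p.
Proof.
move=> cp; rewrite mulr_ge0//; apply: le_bigmin => // i _.
by have /andP[] := cp i.
Qed.

Lemma scaled_min_nondecreasing p q : (forall i, tnth p i <= tnth q i) ->
  scaled_min p <= scaled_min q.
Proof. by move=> pq; rewrite ler_wpM2l// le_bigmin2. Qed.

Lemma measurable_scaled_min : measurable_fun setT scaled_min.
Proof.
apply: measurable_funM => //.
have m (s : seq 'I_K) : measurable_fun setT
    (fun p : K.-tuple R => \big[Num.min/1]_(i <- s) tnth p i).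
  elim: s => [|i s IH].
    by under eq_fun do rewrite big_nil; exact: measurable_cst.
  under eq_fun do rewrite big_cons.
  by apply: measurable_minr => //; exact: measurable_tnth.
exact: m.
Qed.

End means.

(** * Validity *)

Lemma measurable_unit_cube (R : realType) (K : nat) :
  measurable (@unit_cube R K).
Proof.
rewrite (_ : @unit_cube R K =
    \bigcap_(i in [set: 'I_K]) (@tnth K R ^~ i @^-1` `[0, 1])); last first.
  apply/seteqP; split => p cp i.
    by move=> _; rewrite /= in_itv; exact: cp.
  by have := cp i Logic.I; rewrite /= in_itv.
apply: fin_bigcap_measurable => // i _.
by rewrite -[X in measurable X]setTI; exact: measurable_tnth.
Qed.

Section merging.
Context (R : realType) (d : measure_display) (T : measurableType d).
Context (P : probability T R) (K : nat).
Implicit Types (F : K.-tuple R -> R) (U : 'I_K -> {RV P >-> R}).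

Lemma measurable_le_event F U (e : R) :
  measurable_fun (@unit_cube R K) F -> measurable (le_event F U e).
Proof.
move=> mF; pose U' w := [tuple U i w | i < K].
have mU : measurable_fun setT U'.
  apply/measurable_fun_tnthP => i.
  rewrite (_ : _ \o _ = U i); first exact: measurable_funPT.
  by apply/funext => w /=; rewrite tnth_mktuple.
rewrite (_ : le_event F U e =
    U' @^-1` (@unit_cube R K `&` F @^-1` `]-oo, e])); last first.
  by apply/seteqP; split => w [/= cU FU]; split => //;
    move: FU; rewrite /= in_itv.
rewrite -[X in measurable X]setTI; apply: mU => //.
exact: mF (@measurable_unit_cube R K) _ (measurable_itv _).
Qed.

(** Markov's inequality for [\sum_i phi (U_i)], whose expectation depends on
    the marginal laws only: [phi] certifies the bound for every joint law. *)
Lemma prob_le_event_dual F U (e : R) (phi : R -> R) :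
  measurable_fun (@unit_cube R K) F -> (forall i, uniform01 (U i)) ->
  measurable_fun setT phi -> (forall x, 0 <= phi x) ->
  (forall p, unit_cube p -> F p <= e -> 1 <= \sum_(i < K) phi (tnth p i)) ->
  (K%:R%:E * \int[lebesgue_measure]_(x in `[0%R, 1%R]) (phi x)%:E <= e%:E)%E ->
  (P (le_event F U e) <= e%:E)%E.
Proof.
move=> mF unifU mphi phi0 phi1; apply: le_trans.
have mA := @measurable_le_event F U e mF.
have mphiE : measurable_fun setT (EFin \o phi) by exact/measurable_EFinP.
rewrite -[X in P X]setIT -integral_indic//.
apply: (@le_trans _ _ (\int[P]_w \sum_(i < K) (phi (U i w))%:E)%E).
  apply: ge0_le_integral => //.
  - by apply/measurable_EFinP; exact: measurable_indic.
  - apply: emeasurable_sum => i.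
    exact: (measurableT_comp mphiE (measurable_funPT (U i))).
  move=> w _; rewrite sumEFin lee_fin indicE.
  case: (boolP (w \in _)) => [|_]; last by apply: sumr_ge0 => i _.
  rewrite inE => -[cU FU]; have := phi1 _ cU FU.
  by under eq_bigr do rewrite tnth_mktuple.
rewrite ge0_integral_sum//; last 2 first.
- by move=> i; exact: (measurableT_comp mphiE (measurable_funPT (U i))).
- by move=> i w _; rewrite lee_fin.
rewrite (eq_bigr
  (fun=> \int[lebesgue_measure]_(x in `[0%R, 1%R]) (phi x)%:E)%E).
  by rewrite big_const_ord iter_addr_0 mule_natl.
move=> i _.
have mU : measurable_fun setT (U i : T -> measurableTypeR R).
  exact: (@measurable_funPT _ _ _ _ (U i)).
pose V : {RV P >-> measurableTypeR R} :=
  HB.pack (U i : T -> measurableTypeR R) (isMeasurableFun.Build _ _ _ _ _ mU).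
have mphiE' : measurable_fun [set: measurableTypeR R] (EFin \o phi) := mphiE.
transitivity (\int[distribution P V]_y (EFin \o phi) y)%E.
  by rewrite (ge0_integral_distribution V mphiE')// => y; rewrite lee_fin.
rewrite (eq_measure_integral (uniform_prob (@ltr01 R))) => [|B mB _].
  2: exact: unifU.
rewrite integral_uniform//.
by rewrite subr0 invr1 mul1e.
Qed.
End merging.

(** Beyond [u] the primitive [u `^ (- r) / (r + 1) * x `^ (r + 1)] is used; its
    value at 1 is negative and is dropped, so the bound is the integral over
    the whole half-line. *)
Lemma integral_capped_power (R : realType) (r u : R) : r < -1 -> 0 < u < 1 ->
  (\int[lebesgue_measure]_(x in `[0%R, 1%R])
     (if x <= u then 1 else (x / u) `^ r)%:E <= (u * (r / (r + 1)))%:E)%E.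
Proof.
move=> r1 /andP[u0 u1].
pose phi x := if x <= u then 1 else (x / u) `^ r.
pose f x := u `^ (- r) * x `^ r.
pose F x := u `^ (- r) / (r + 1) * x `^ (r + 1).
have mpow (s : R) : measurable_fun setT (fun x => x `^ s : R).
  exact: measurable_powR.
have mphi : measurable_fun setT (EFin \o phi).
  apply/measurable_EFinP; apply: measurable_fun_ifT => //.
    exact: measurable_fun_ler.
  by apply: (measurableT_comp (mpow r)); exact: measurable_funM.
have phi0 x : 0 <= phi x by rewrite /phi; case: ifP => // _; exact: powR_ge0.
have dF (x : R) : 0 < x -> is_derive x 1 F (f x).
  move=> x0; have D := is_derive1_powR (r + 1) x0.
  have := is_deriveZ (u `^ (- r) / (r + 1)) D.
  rewrite addrK /f; rewrite (_ : _ *: _ = u `^ (- r) * x `^ r)//.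
  by rewrite /GRing.scale/= mulrA divfK// lt_eqF//; lra.
have cF (x : R) : 0 < x -> {for x, continuous F}.
  move=> x0; apply/differentiable_continuous/derivable1_diffP.
  by have [] := dF x x0.
have cf (x : R) : 0 < x -> {for x, continuous f}.
  move=> x0; have cp : {for x, continuous (fun y : R => y `^ r)}.
    apply/differentiable_continuous/derivable1_diffP/derivable_powR.
    by rewrite in_itv/= x0.
  by apply: cvgM; [exact: cvg_cst|exact: cp].
rewrite (@itv_bndbnd_setU _ _ _ (BRight u)) ?bnd_simp ?(ltW u0) ?(ltW u1)//.
rewrite ge0_integral_setU//=; last 3 first.
- exact: measurable_funTS.
- by move=> x _; rewrite lee_fin; exact: phi0.
- apply/disj_setPS => x /= []; rewrite !in_itv/= => /andP[_ xu] /andP[ux _].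
  by move: xu; rewrite leNgt ux.
rewrite (eq_integral (fun=> 1%E)) => [|x]; last first.
  by rewrite inE/= in_itv/= => /andP[_ ->].
rewrite integral_cst//= mul1e lebesgue_measure_itv/= lte_fin u0 sube0.
rewrite (eq_integral (fun x : measurableTypeR R => (f x)%:E)) => [|x].
2: {
  rewrite inE/= in_itv/= => /andP[ux _]; rewrite leNgt ux/= /f.
  rewrite powRM ?invr_ge0 ?ltW// ?(lt_trans u0)// mulrC; congr (_ * _)%:E.
  by rewrite powR_invl ?ltW// powRN. }
rewrite integral_itv_obnd_cbnd; last first.
  by apply/measurable_EFinP/measurable_funTS/measurable_funM.
rewrite (@continuous_FTC2 R f F u 1)//; first last.
- move=> x; rewrite in_itv/= => /andP[ux _].
  by rewrite derive1E; have [_ ->] := dF x (lt_trans u0 ux).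
- split.
  + move=> x; rewrite in_itv/= => /andP[ux _].
    by have [] := dF x (lt_trans u0 ux).
  + exact/cvg_at_right_filter/cF.
  + exact/cvg_at_left_filter/cF.
- apply: continuous_in_subspaceT => x; rewrite inE/= in_itv/= => /andP[ux _].
  exact/cf/(lt_le_trans u0 ux).
rewrite -EFinB -EFinD lee_fin /F powR1.
have -> : u `^ (- r) / (r + 1) * u `^ (r + 1) = u / (r + 1).
  rewrite mulrAC -powRD; last by apply/implyP => _; rewrite gt_eqF.
  by rewrite addKr powRr1 ?ltW.
have : u `^ (- r) / (r + 1) <= 0.
  by rewrite mulr_ge0_le0 ?powR_ge0// invr_le0; lra.
have -> : u * (r / (r + 1)) = u - u / (r + 1) by field; lra.
lra.
Qed.

Section validity.
Context (R : realType) (d : measure_display) (T : measurableType d).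
Context (P : probability T R) (K : nat) (K0 : (0 < K)%N).

Lemma le_update (p q : K.-tuple R) (i : 'I_K) :
  (forall j, j != i -> tnth p j = tnth q j) -> tnth p i <= tnth q i ->
  forall j, tnth p j <= tnth q j.
Proof. by move=> pq pqi j; have [->|/pq->] := eqVneq j i. Qed.

Lemma merging_scaled_mean_fin (r : R) : r < -1 ->
  merging_function P (fun p : K.-tuple R => scaled_mean r%:E p).
Proof.
move=> r1; have K0R : 0 < K%:R :> R by rewrite ltr0n.
have mF : measurable_fun (@unit_cube R K) (fun p => scaled_mean r%:E p).
  apply: (@eq_measurable_fun _ _ _ _ _ (@scaled_power_mean R K r)).
    by move=> p; rewrite inE => cp; rewrite scaled_mean_fin.
  by apply: measurable_funTS; exact: measurable_scaled_power_mean.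
split => //.
- by move=> p cp; rewrite (scaled_mean_fin r1 K0 cp) scaled_power_mean_ge0.
- move=> p q i cp cq pq pqi.
  rewrite (scaled_mean_fin r1 K0 cp) (scaled_mean_fin r1 K0 cq).
  by apply: scaled_power_mean_nondecreasing => //; exact: le_update pq pqi.
move=> e /andP[e0 e1]; apply: ge_ereal_sup => _ [U unifU <-].
pose u := (r + 1) / r * e / K%:R.
have uE : K%:R * (u * (r / (r + 1))) = e.
  rewrite /u; field; do ?[apply/andP; split]; rewrite ?(gt_eqF K0R)//; lra.
have c01 : 0 < (r + 1) / r < 1.
  by rewrite -mulrNN -invrN divr_gt0 ?ltr_pdivrMr//; lra.
have u01 : 0 < u < 1.
  have /andP[c0 c1] := c01; rewrite /u; apply/andP; split.
    by rewrite divr_gt0// mulr_gt0.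
  rewrite ltr_pdivrMr// mul1r (@lt_le_trans _ _ 1) ?ler1n//.
  by rewrite mulr_ilt1// ltW.
have /andP[u0 u1] := u01.
have phi0 x : 0 <= (if x <= u then 1 else (x / u) `^ r).
  by case: ifP => // _; exact: powR_ge0.
apply: (prob_le_event_dual mF unifU _ phi0) => //.
- apply: measurable_fun_ifT => //; first exact: measurable_fun_ler.
  by apply: (measurableT_comp (measurable_powR r)); exact: measurable_funM.
- move=> p cp; rewrite (scaled_mean_fin r1 K0 cp).
  rewrite (scaled_power_mean_le r1 K0 e0 cp) -/u.
  have [/existsP[i pu] _|] := boolP [exists i, tnth p i <= u].
    rewrite (bigD1 i)//= pu lerDl; exact: sumr_ge0.
  rewrite negb_exists => /forallP pu.
  have p0 i : 0 < tnth p i by rewrite (lt_trans u0)// ltNge.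
  rewrite gt_eqF ?prodr_gt0//= => S.
  rewrite (eq_bigr (fun i => tnth p i `^ r / u `^ r)) => [|i _]; last first.
    by rewrite (negPf (pu i)) powRM ?invr_ge0 ?ltW// powR_invl ?ltW.
  by rewrite -mulr_suml ler_pdivlMr ?powR_gt0// mul1r.
rewrite -[in leRHS]uE EFinM lee_wpmul2l ?lee_fin//.
exact: integral_capped_power.
Qed.

Lemma merging_scaled_mean_Ny :
  merging_function P (fun p : K.-tuple R => scaled_mean -oo%E p).
Proof.
have K0R : 0 < K%:R :> R by rewrite ltr0n.
have mF : measurable_fun (@unit_cube R K) (fun p => scaled_mean -oo%E p).
  apply: (@eq_measurable_fun _ _ _ _ _ (@scaled_min R K)).
    by move=> p; rewrite inE => cp; rewrite scaled_mean_Ny.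
  by apply: measurable_funTS; exact: measurable_scaled_min.
split => //.
- by move=> p cp; rewrite (scaled_mean_Ny K0 cp) scaled_min_ge0.
- move=> p q i cp cq pq pqi.
  rewrite (scaled_mean_Ny K0 cp) (scaled_mean_Ny K0 cq).
  by apply: scaled_min_nondecreasing; exact: le_update pq pqi.
move=> e /andP[e0 e1]; apply: ge_ereal_sup => _ [U unifU <-].
pose I : set R := `]-oo, e / K%:R]%classic.
have eK : e < K%:R by rewrite (lt_le_trans e1)// ler1n.
have eK0 : 0 < e / K%:R by rewrite divr_gt0.
have eK1 : e / K%:R <= 1.
  by rewrite ler_pdivrMr// mul1r (le_trans (ltW e1))// ler1n.
apply: (@prob_le_event_dual _ _ _ _ _ _ _ _ (\1_I) mF unifU) => //.
- by apply: measurable_indic; exact: measurable_itv.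
- move=> p cp; rewrite (scaled_mean_Ny K0 cp) (scaled_min_le _ K0 eK).
  move=> /existsP[i pe]; have Ip : tnth p i \in I by rewrite inE /I/= in_itv.
  by rewrite (bigD1 i)//= indicE Ip lerDl; exact: sumr_ge0.
rewrite integral_indic; [|exact: measurable_itv|exact: measurable_itv].
rewrite (_ : _ `&` _ = `[0, e / K%:R]%classic); last first.
  apply/seteqP; split => x; rewrite /= !in_itv/=.
    by move=> [xe /andP[-> _]].
  by move=> /andP[-> xe]; split => //; rewrite (le_trans xe).
rewrite /= lebesgue_measure_itv/= lte_fin eK0 sube0 -EFinM lee_fin.
by rewrite mulrCA divff ?mulr1// gt_eqF.
Qed.

End validity.

(** * Asymptotic precision *)

Section precision.
Context (R : realType) (d : measure_display) (T : measurableType d).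
Context (P : probability T R) (hP : atomless P).

(** A single joint law violating the bound at one level suffices. *)
Lemma not_merging (K : nat) (F : K.-tuple R -> R) (e : R) (A : set T)
    (U : 'I_K -> {RV P >-> R}) :
  0 < e < 1 -> measurable A -> (e%:E < P A)%E -> (forall i, uniform01 (U i)) ->
  (forall w, A w -> le_event F U e w) -> ~ merging_function P F.
Proof.
move=> e01 mA eA unifU AF [mF _ _ /(_ _ e01) supF].
have : (e%:E < ereal_sup [set P (le_event F U e) | U in
    [set U : 'I_K -> {RV P >-> R} | forall i, uniform01 (U i)]])%E.
  apply: (lt_le_trans eA); apply: (@le_trans _ _ (P (le_event F U e))).
    by apply: le_measure; rewrite ?inE//; exact: measurable_le_event.
  by apply: ereal_sup_ubound; exists U.
by rewrite ltNge supF.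
Qed.

(** On a good row the columns visiting the cells of its group have
    coordinates at most [t.+1 / (n K)]; the powers of these bounds already sum
    to [((r + 1) / r * b / K) `^ r], and the other coordinates only add to the
    sum. *)
Lemma precise_scaled_mean_fin (r : R) : r < -1 ->
  asymptotically_precise P
    (fun (K : nat) (p : K.-tuple R) => scaled_mean r%:E p).
Proof.
move=> r1 a /andP[a0 a1].
pose e := (1 + a) / 2; pose b := e / a.
have e01 : 0 < e < 1 by rewrite /e; lra.
have /andP[e0 e1] := e01.
have b1 : 1 < b by rewrite /b ltr_pdivlMr// mul1r /e; lra.
have b0 : 0 < b by exact: lt_trans b1.
have [||n [m [f [good [n0 card_good cover]]]]] :=
  @harmonic_covering R (- (r + 1)) _ b ((1 - e) / 2) b1.
- lra.
- lra.
exists m => K K2 mK; have K0 : (0 < K)%N by exact: ltn_trans K2.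
have n0R : 0 < n%:R :> R by rewrite ltr0n.
have K0R : 0 < K%:R :> R by rewrite ltr0n.
have [U [row [unifU U01 rowP colP]]] :=
  uniform_arrangement (fun t : 'I_K => f t) hP n0 K0.
have [mgood pgood] := rowP good.
apply: (not_merging e01 mgood _ unifU).
  rewrite pgood lte_fin ltr_pdivlMr//; apply: lt_le_trans card_good.
  by rewrite ltr_pM2r//; lra.
move=> w good_w; set p := [tuple U i w | i < K].
have cp : unit_cube p by move=> i; rewrite tnth_mktuple.
split => //; rewrite -/p mulrC -ler_pdivlMr// -/b.
rewrite (scaled_mean_fin r1 K0 cp) (scaled_power_mean_le r1 K0 b0 cp).
case: eqP => //= /eqP/(prod_tnth_neq0 cp) p0.
have r0 : r < 0 by lra.
have [col col_inj colU] := colP w.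
rewrite (reindex_inj col_inj)/=.
pose s := (n%:R * K%:R : R) `^ r.
have s0 : 0 < s by rewrite powR_gt0// mulr_gt0.
have nK0 : 0 < (n%:R * K%:R : R) by rewrite mulr_gt0.
apply: (@le_trans _ _ (\sum_(t < K | f t == row w) (t.+1%:R `^ r / s))).
  2: {
  rewrite big_mkcond/=; apply: ler_sum => t _.
  case: eqP => [/colU le_t|_]; last exact: powR_ge0.
  have -> : t.+1%:R `^ r / s = (t.+1%:R / (n%:R * K%:R)) `^ r.
    by rewrite powRM ?invr_ge0 ?(ltW nK0)// powR_invl ?(ltW nK0).
  rewrite powR_lt0_le ?divr_gt0//.
  by rewrite tnth_mktuple. }
have -> : ((r + 1) / r * b / K%:R) `^ r = ((r + 1) / r * b * n%:R) `^ r / s.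
  have c0 : 0 < (r + 1) / r by rewrite -mulrNN -invrN divr_gt0//; lra.
  rewrite /s -powR_invl ?(ltW nK0)// -powRM ?invr_ge0 ?(ltW nK0)//; last first.
    by apply: mulr_ge0; [apply: mulr_ge0|]; exact: ltW.
  congr (_ `^ _); field.
  do ?[apply/andP; split]; rewrite ?(gt_eqF K0R) ?(gt_eqF n0R)//; lra.
rewrite -mulr_suml ler_pM2r ?invr_gt0//.
have := cover _ good_w.
have -> : - (r + 1) + 1 = - r by rewrite opprD addrNK.
rewrite opprK invrN mulrNN => /le_trans; apply.
rewrite (big_ord_widen_cond K (fun t => f t == row w)
  (fun t => t.+1%:R `^ r))//.
rewrite [leRHS](bigID (fun t : 'I_K => (t < m)%N))/= lerDl.
by apply: sumr_ge0 => t _; exact: powR_ge0.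
Qed.

(** With a single row all columns together visit every cell, in particular
    the first one, so the minimum is always at most [1 / K]. *)
Lemma precise_scaled_mean_Ny :
  asymptotically_precise P
    (fun (K : nat) (p : K.-tuple R) => scaled_mean -oo%E p).
Proof.
move=> a /andP[a0 a1]; pose e := (1 + a) / 2.
have e01 : 0 < e < 1 by rewrite /e; lra.
have /andP[e0 e1] := e01.
exists 0%N => K K2 _; have K0 : (0 < K)%N by exact: ltn_trans K2.
have K0R : 0 < K%:R :> R by rewrite ltr0n.
have [U [row [unifU U01 _ colP]]] :=
  uniform_arrangement (fun _ : 'I_K => @ord0 0) hP (ltn0Sn 0) K0.
apply: (not_merging e01 measurableT _ unifU).
  by rewrite probability_setT lte_fin.
move=> w _; set p := [tuple U i w | i < K].
have cp : unit_cube p by move=> i; rewrite tnth_mktuple.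
split => //; rewrite -/p (scaled_mean_Ny K0 cp).
have [col _ /(_ (Ordinal K0))] := colP w.
move=> /(_ (esym (ord1 _))); rewrite /= !mul1r => Ucol.
have : scaled_min p <= 1.
  rewrite /scaled_min mulrC -ler_pdivlMr// div1r.
  by apply: (bigmin_inf (col (Ordinal K0))) => //; rewrite tnth_mktuple.
by move=> /(ler_wpM2l (ltW a0)); rewrite /e; lra.
Qed.

End precision.

Unset Implicit Arguments.

Theorem proposition8 (R : realType) (d : measure_display)
    (T : measurableType d) (P : probability T R) (hP : atomless P)
    (r : \bar R) (hr : (r < (-1)%:E)%E) :
  (forall K : nat, (2 <= K)%N ->
     merging_function P (fun p : K.-tuple R => scaled_mean r p)) /\
  asymptotically_precise P (fun (K : nat) (p : K.-tuple R) => scaled_mean r p).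
Proof.
case: r hr => [r|//|_].
  rewrite lte_fin => r1; split=> [K K2|]; last exact: precise_scaled_mean_fin.
  by apply: merging_scaled_mean_fin => //; exact: ltn_trans K2.
split=> [K K2|]; last exact: precise_scaled_mean_Ny.
by apply: merging_scaled_mean_Ny; exact: ltn_trans K2.
Qed.
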